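(* Let $\eta^{ij}$ be a constant nondegenerate symmetric $N\times N$ matrix. Consider the Gauss equations $$\sum_{\alpha=1}^L\sum_{\beta=1}^L\mu^{\alpha\beta}\left(\frac{\partial^2\psi_\alpha}{\partial u^i\partial u^k}\frac{\partial^2\psi_\beta}{\partial u^j\partial u^l}-\frac{\partial^2\psi_\alpha}{\partial u^i\partial u^l}\frac{\partial^2\psi_\beta}{\partial u^j\partial u^k}\right)=0,\qquad 1\le i,j,k,l\le N,$$ and the Ricci equations $$\sum_{i=1}^N\sum_{j=1}^N\eta^{ij}\left(\frac{\partial^2\psi_\alpha}{\partial u^i\partial u^k}\frac{\partial^2\psi_\beta}{\partial u^j\partial u^l}-\frac{\partial^2\psi_\alpha}{\partial u^i\partial u^l}\frac{\partial^2\psi_\beta}{\partial u^j\partial u^k}\right)=0,\qquad 1\le k,l\le N,\ 1\le\alpha,\beta\le L,$$ for functions $\psi_\alpha(u^1,\dots,u^N)$, $1\le\alpha\le L$, where $\mu^{\alpha\beta}$ is a constant nondegenerate symmetric $L\times L$ matrix. If $L=N$, $\mu^{ij}=c\,\eta^{ij}$, $1\le i,j\le N$, where $c$ is an arbitrary nonzero constant, and $\psi_\alpha(u)=\partial\Phi/\partial u^\alpha$, $1\le\alpha\le N$, where $\Phi=\Phi(u^1,\dots,u^N)$, then the Gauss equations coincide with the Ricci equations, and each of them coincides with the associativity (WDVV) equations $$\sum_{k=1}^N\sum_{l=1}^N\frac{\partial^3\Phi}{\partial u^i\partial u^j\partial u^k}\eta^{kl}\frac{\partial^3\Phi}{\partial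 u^l\partial u^m\partial u^n}=\sum_{k=1}^N\sum_{l=1}^N\frac{\partial^3\Phi}{\partial u^i\partial u^m\partial u^k}\eta^{kl}\frac{\partial^3\Phi}{\partial u^l\partial u^j\partial u^n},\qquad 1\le i,j,m,n\le N,$$ for the potential $\Phi(u)$.
   Context: All functions are smooth. ''Coincide'' means that the systems of equations (over all values of the free indices) are equivalent. *)

(* Defs.v *)
From HB Require Import structures.
From mathcomp Require Import all_boot all_order all_algebra.
From mathcomp Require Import all_classical all_reals all_analysis.

Set Implicit Arguments.
Unset Strict Implicit.
Unset Printing Implicit Defensive.
Import Order.TTheory GRing.Theory Num.Theory.
Import numFieldNormedType.Exports.
Local Open Scope classical_set_scope.
Local Open Scope ring_scope.

(* Points u = (u^1, ..., u^N) are row vectors. *)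
Definition partial (R : realType) (N : nat) (i : 'I_N) (f : 'rV[R]_N -> R)
  : 'rV[R]_N -> R :=
  fun u => 'D_(delta_mx 0 i) f u.

(* iter_partial [:: i; j; k] f = d_i (d_j (d_k f)) *)
Definition iter_partial (R : realType) (N : nat) (s : seq 'I_N)
  (f : 'rV[R]_N -> R) : 'rV[R]_N -> R :=
  foldr (@partial R N) f s.

(* C^infinity on U, for U open: the partial derivatives of all orders exist and
   are continuous at every point of U.  Since U is open, the values of f outside
   U are irrelevant. *)
Definition smooth_on (R : realType) (N : nat) (U : set 'rV[R]_N)
  (f : 'rV[R]_N -> R) : Prop :=
  forall (s : seq 'I_N) (u : 'rV[R]_N), U u ->
    {for u, continuous (iter_partial s f)} /\
    (forall i : 'I_N, derivable (iter_partial s f) u (delta_mx 0 i)).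

Definition symmetric_nondegenerate (R : realType) (n : nat) (A : 'M[R]_n)
  : Prop :=
  A^T = A /\ A \in unitmx.

(* Each of the three systems is stated at a point u; as a system of PDEs on a
   domain U it is required at every u in U. *)

Definition gauss_equations (R : realType) (N L : nat) (mu : 'M[R]_L)
  (psi : 'I_L -> 'rV[R]_N -> R) (u : 'rV[R]_N) : Prop :=
  forall i j k l : 'I_N,
    \sum_(a < L) \sum_(b < L) mu a b *
      (partial i (partial k (psi a)) u * partial j (partial l (psi b)) u
       - partial i (partial l (psi a)) u * partial j (partial k (psi b)) u)
    = 0.

Definition ricci_equations (R : realType) (N L : nat) (eta : 'M[R]_N)
  (psi : 'I_L -> 'rV[R]_N -> R) (u : 'rV[R]_N) : Prop :=
  forall (k l : 'I_N) (a b : 'I_L),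
    \sum_(i < N) \sum_(j < N) eta i j *
      (partial i (partial k (psi a)) u * partial j (partial l (psi b)) u
       - partial i (partial l (psi a)) u * partial j (partial k (psi b)) u)
    = 0.

Definition wdvv_equations (R : realType) (N : nat) (eta : 'M[R]_N)
  (Phi : 'rV[R]_N -> R) (u : 'rV[R]_N) : Prop :=
  forall i j m n : 'I_N,
    \sum_(k < N) \sum_(l < N)
      partial i (partial j (partial k Phi)) u * eta k l *
      partial l (partial m (partial n Phi)) u
    = \sum_(k < N) \sum_(l < N)
      partial i (partial m (partial k Phi)) u * eta k l *
      partial l (partial j (partial n Phi)) u.

(* Main.v *)
(* With psi_a = d_a Phi, all the second derivatives in the Gauss and Ricci
   equations become third derivatives of Phi.  By the symmetry of mixed partial
   derivatives, proved here by comparing the two mean value expressions of a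
   second difference, these form a totally symmetric tensor T, and both systems
   reduce to the WDVV equations by permuting the indices of T. *)
Require Import Defs.
From HB Require Import structures.
From mathcomp Require Import all_boot all_order all_algebra.
From mathcomp Require Import all_classical all_reals all_analysis.
From mathcomp Require Import ring.

Set Implicit Arguments.
Unset Strict Implicit.
Unset Printing Implicit Defensive.
Import Order.TTheory GRing.Theory Num.Theory.
Import numFieldNormedType.Exports.
Local Open Scope classical_set_scope.
Local Open Scope ring_scope.

Section Schwarz.
Variables (R : realType) (V : normedModType R).
Implicit Types (f : V -> R) (u v w : V).

(** The two difference quotients agree for every increment, so derivability along the single
    direction [v] suffices; a chain rule through the differential would ask for more. *)
Lemma is_derive_translate f u v a :
  derivable f (u + a) v ->
  is_derive u v (fun x => f (x + a)) ('D_v f (u + a)).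
Proof.
have eq_quot : (fun h : R => h^-1 *: (((fun x => f (x + a)) \o shift u) (h *: v)
    - f (u + a))) = (fun h => h^-1 *: ((f \o shift (u + a)) (h *: v) - f (u + a))).
  by apply/funext => h /=; rewrite addrA.
by move=> df; split; rewrite /derivable /derive /= eq_quot.
Qed.

Lemma is_derive_line f u v (t : R) :
  derivable f (t *: v + u) v ->
  is_derive t 1 (fun s : R => f (s *: v + u)) ('D_v f (t *: v + u)).
Proof.
have eq_quot : (fun h : R => h^-1 *: (((fun s : R => f (s *: v + u)) \o shift t)
    (h *: 1) - f (t *: v + u))) =
    (fun h => h^-1 *: ((f \o shift (t *: v + u)) (h *: v) - f (t *: v + u))).
  by apply/funext => h /=; rewrite [h%:A]mulr1 scalerDl addrA.
by move=> df; split; rewrite /derivable /derive /= eq_quot.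
Qed.

Lemma MVT_line f u v (h : R) : 0 < h ->
  (forall t, 0 <= t <= h -> derivable f (t *: v + u) v) ->
  exists2 t, 0 <= t <= h & f (h *: v + u) - f u = 'D_v f (t *: v + u) * h.
Proof.
move=> h0 df.
have dl (t : R) : t \in `[0, h] ->
    is_derive t 1 (fun s : R => f (s *: v + u)) ('D_v f (t *: v + u)).
  by rewrite in_itv => /df /is_derive_line.
have cl : {within `[0, h], continuous (fun s : R => f (s *: v + u))}.
  by apply: derivable_within_continuous => t /dl [].
have dlo (t : R) : t \in `]0, h[ ->
    is_derive t 1 (fun s : R => f (s *: v + u)) ('D_v f (t *: v + u)).
  by move=> /subset_itv_oo_cc; exact: dl.
have [t] := MVT_segment (ltW h0) dlo cl.
by rewrite in_itv subr0 scale0r add0r => t0h ft; exists t.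
Qed.

(** The second difference is the increment along [v] of [g x = f (x + h *: w) - f x]. The mean value
    theorem for [g] yields [s]; the resulting derivative of [g] is itself an increment of ['D_v f]
    along [w], and a second application yields [t]. *)
Lemma second_difference_MVT f u v w (h : R) : 0 < h ->
  (forall s t, 0 <= s <= h -> 0 <= t <= h ->
    derivable f (s *: v + t *: w + u) v /\
    derivable ('D_v f) (s *: v + t *: w + u) w) ->
  exists s t, [/\ 0 <= s <= h, 0 <= t <= h &
    f (h *: v + h *: w + u) - f (h *: v + u) - (f (h *: w + u) - f u)
    = 'D_w ('D_v f) (s *: v + t *: w + u) * h * h].
Proof.
move=> h0 df; have hh : 0 <= h <= h by rewrite lexx ltW.
have z0 : 0 <= (0 : R) <= h by rewrite lexx ltW.
have dg s : 0 <= s <= h -> is_derive (s *: v + u) v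
    ((fun x => f (x + h *: w)) \- f)
    ('D_v f (s *: v + u + h *: w) - 'D_v f (s *: v + u)).
  move=> s0h; apply: is_deriveB.
    apply: is_derive_translate; rewrite (addrAC (s *: v)).
    exact: (df s h s0h hh).1.
  apply: derivableP; have [+ _] := df s 0 s0h z0.
  by rewrite scale0r addr0.
have [s s0h gs] := MVT_line h0 (fun s s0h => @ex_derive _ _ _ _ _ _ _ (dg s s0h)).
have dk t : 0 <= t <= h -> derivable ('D_v f) (t *: w + (s *: v + u)) w.
  by move=> t0h; have [_] := df s t s0h t0h; rewrite addrCA addrA.
have [t t0h kt] := MVT_line h0 dk.
exists s, t; split; [by []|by []|].
have <- : t *: w + (s *: v + u) = s *: v + t *: w + u by rewrite addrCA addrA.
rewrite -kt.
have -> : 'D_v f (h *: w + (s *: v + u)) - 'D_v f (s *: v + u) =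
    'D_v ((fun x => f (x + h *: w)) \- f) (s *: v + u).
  by rewrite (@derive_val _ _ _ _ _ _ _ (dg s s0h)) (addrC (h *: w)).
by rewrite -gs /= (addrAC (h *: v)) [u + _]addrC; ring.
Qed.

(** On a small parallelogram at [u], one second difference is expressed through each mixed
    derivative in turn. So the two take a common value at points near [u], and by continuity each is
    within [e / 2] of it at [u]. *)
Lemma derive_comm f u v w :
  (\forall x \near u, [/\ derivable f x v, derivable f x w,
     derivable ('D_v f) x w & derivable ('D_w f) x v]) ->
  {for u, continuous ('D_w ('D_v f))} -> {for u, continuous ('D_v ('D_w f))} ->
  'D_w ('D_v f) u = 'D_v ('D_w f) u.
Proof.
move=> df cwv cvw; apply/eqP; rewrite -subr_eq0 -normr_le0.
apply/ler_addgt0Pl => e e0; rewrite addr0.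
have e20 : 0 < e / 2 by rewrite divr_gt0.
have /nbhs_ballP[r /= r0 br] : \forall x \near u,
    [/\ derivable f x v, derivable f x w, derivable ('D_v f) x w
      & derivable ('D_w f) x v] /\
    (`|'D_w ('D_v f) u - 'D_w ('D_v f) x| < e / 2 /\
     `|'D_v ('D_w f) u - 'D_v ('D_w f) x| < e / 2).
  move/cvgrPdist_lt: cwv => /(_ _ e20) cwv; move/cvgrPdist_lt: cvw => /(_ _ e20) cvw.
  exact: filterI df (filterI cwv cvw).
(* With [h = r / m] the parallelogram spanned by [h *: v] and [h *: w] stays in the ball of radius
   [r]; the summand 1 makes the bound strict and keeps [m] positive when [v] and [w] vanish. *)
pose m := `|v| + `|w| + 1.
have m0 : 0 < m by rewrite ltr_wpDl// addr_ge0.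
pose h := r / m.
have h0 : 0 < h by rewrite divr_gt0.
have bh s t : 0 <= s <= h -> 0 <= t <= h -> ball u r (s *: v + t *: w + u).
  move=> /andP[s0 sh] /andP[t0 th]; rewrite -ball_normE /= opprD addrCA subrr addr0.
  rewrite normrN (le_lt_trans (ler_normD _ _))// !normrZ !ger0_norm//.
  rewrite (@le_lt_trans _ _ (h * `|v| + h * `|w|))//.
    by rewrite lerD// ler_wpM2r.
  by rewrite -mulrDr /h mulrAC ltr_pdivrMr// ltr_pM2l// ltrDl.
have [s t|s [t [sh th Est]]] := @second_difference_MVT f u v w h h0.
  by move=> s0 t0; have [[fv _ fvw _] _] := br _ (bh s t s0 t0).
have [s' t'|s' [t' [sh' th' Est']]] := @second_difference_MVT f u w v h h0.
  move=> s0 t0; rewrite (addrC (s' *: w)).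
  by have [[_ fw _ fwv] _] := br _ (bh t' s' t0 s0); split; [exact: fw|exact: fwv].
have hn0 : h != 0 by rewrite gt_eqF.
(* The second difference is symmetric in [v] and [w], so cancelling [h] twice equates the two mixed
   derivatives at their respective intermediate points. *)
have same_difference :
    f (h *: v + h *: w + u) - f (h *: v + u) - (f (h *: w + u) - f u) =
    f (h *: w + h *: v + u) - f (h *: w + u) - (f (h *: v + u) - f u).
  by rewrite (addrC (h *: w) (h *: v)); ring.
have /(mulIf hn0)/(mulIf hn0) same_value :=
  etrans (esym Est) (etrans same_difference Est').
have [_ [Ewv _]] := br _ (bh s t sh th).
have := bh t' s' th' sh'; rewrite (addrC (t' *: v)) => /br[_ [_ Evw]].
by apply/ltW/(distm_lt_splitl Ewv); rewrite same_value; exact: Evw.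
Qed.

End Schwarz.

Section IteratedPartials.
Variables (R : realType) (N : nat) (U : set 'rV[R]_N).
Hypothesis U_open : open U.
Implicit Types (f g : 'rV[R]_N -> R) (u : 'rV[R]_N).

(** A derivative at [u] depends only on values near [u], and the open set [U] is a neighbourhood of
    each of its points. *)
Lemma partial_eq_on f g : (forall u, U u -> f u = g u) ->
  forall i u, U u -> partial i f u = partial i g u.
Proof.
move=> fg i u Uu; apply: near_eq_derive.
by apply: filterS (open_nbhs_nbhs (conj U_open Uu)) => x /fg.
Qed.

Lemma smooth_on_partial f i : smooth_on U f -> smooth_on U (partial i f).
Proof.
by move=> sf s u Uu; have := sf (rcons s i) u Uu; rewrite /iter_partial foldr_rcons.
Qed.

Lemma partialC f i j u : smooth_on U f -> U u ->
  partial i (partial j f) u = partial j (partial i f) u.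
Proof.
move=> sf Uu; apply: derive_comm.
- apply: filterS (open_nbhs_nbhs (conj U_open Uu)) => x Ux.
  split; [exact: (sf [::] x Ux).2|exact: (sf [::] x Ux).2| |].
    exact: (sf [:: j] x Ux).2.
  exact: (sf [:: i] x Ux).2.
- exact: (sf [:: i; j] u Uu).1.
- exact: (sf [:: j; i] u Uu).1.
Qed.

(** The transposition (13) is the product (12)(23)(12) of adjacent ones. Swapping the inner pair
    takes place under a derivative, hence needs commutation on all of [U] and not just at [u]. *)
Lemma third_partialC13 f u i j k : smooth_on U f -> U u ->
  partial i (partial j (partial k f)) u = partial k (partial j (partial i f)) u.
Proof.
move=> sf Uu.
have swap23 a b c :
    partial a (partial b (partial c f)) u = partial a (partial c (partial b f)) u.
  by apply: partial_eq_on Uu => x; exact: partialC.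
apply: (etrans (partialC i j (smooth_on_partial k sf) Uu)).
by apply: (etrans (swap23 j i k)); exact: partialC (smooth_on_partial i sf) Uu.
Qed.

End IteratedPartials.

Section SymmetricTensor.
Variables (F : idomainType) (N : nat) (eta : 'M[F]_N).
Variable T : 'I_N -> 'I_N -> 'I_N -> F.
Hypothesis T13 : forall i j k, T i j k = T k j i.

(** One side of WDVV; exchanging [j] and [m] gives the other. *)
Let P i j m n := \sum_k \sum_l T i j k * eta k l * T l m n.

Lemma contraction_antisym i j k l :
  \sum_a \sum_b eta a b * (T i k a * T j l b - T i l a * T j k b)
  = P i k l j - P i l k j.
Proof.
rewrite /P -sumrB; apply: eq_bigr => a _; rewrite -sumrB; apply: eq_bigr => b _.
by rewrite [T j l b]T13 [T j k b]T13; ring.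
Qed.

Lemma gauss_tensorP (mu : 'M[F]_N) (c : F) : c != 0 ->
  (forall i j, mu i j = c * eta i j) ->
  (forall i j k l,
    \sum_a \sum_b mu a b * (T i k a * T j l b - T i l a * T j k b) = 0) <->
  (forall i j m n, P i j m n = P i m j n).
Proof.
move=> c0 muE.
have gaussE i j k l :
    \sum_a \sum_b mu a b * (T i k a * T j l b - T i l a * T j k b)
    = c * (P i k l j - P i l k j).
  rewrite -contraction_antisym mulr_sumr; apply: eq_bigr => a _.
  by rewrite mulr_sumr; apply: eq_bigr => b _; rewrite muE mulrA.
split=> [gauss i k l j|wdvv i j k l]; last by rewrite gaussE wdvv subrr mulr0.
have /eqP := gauss i j k l.
by rewrite gaussE mulf_eq0 (negPf c0) subr_eq0 => /eqP.
Qed.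

(** Here the contracted indices come first in [T]. Applying [T13] to all four factors moves them
    last, which is the Gauss contraction with [a], [b] in the place of [i], [j]. *)
Lemma ricci_tensorP :
  (forall k l a b,
    \sum_i \sum_j eta i j * (T i k a * T j l b - T i l a * T j k b) = 0) <->
  (forall i j m n, P i j m n = P i m j n).
Proof.
have ricciE k l a b :
    \sum_i \sum_j eta i j * (T i k a * T j l b - T i l a * T j k b)
    = P a k l b - P a l k b.
  rewrite -contraction_antisym; apply: eq_bigr => i _; apply: eq_bigr => j _.
  by rewrite (T13 i k) (T13 j l) (T13 i l) (T13 j k).
split=> [ricci i k l j|wdvv k l a b]; last by rewrite ricciE wdvv subrr.
by have /eqP := ricci k l i j; rewrite ricciE subr_eq0 => /eqP.
Qed.

End SymmetricTensor.

Theorem theorem6p1 (R : realType) (N : nat) (U : set 'rV[R]_N)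
  (eta mu : 'M[R]_N) (c : R)
  (Phi : 'rV[R]_N -> R) (psi : 'I_N -> 'rV[R]_N -> R)
  (U_open : open U)
  (eta_sym : symmetric_nondegenerate eta)
  (mu_sym : symmetric_nondegenerate mu)
  (c_neq0 : c != 0)
  (mu_eta : forall i j : 'I_N, mu i j = c * eta i j)
  (Phi_smooth : smooth_on U Phi)
  (psi_smooth : forall a : 'I_N, smooth_on U (psi a))
  (psi_Phi : forall (a : 'I_N) (u : 'rV[R]_N), U u -> psi a u = partial a Phi u) :
  forall u : 'rV[R]_N, U u ->
    [/\ gauss_equations mu psi u <-> ricci_equations eta psi u,
        gauss_equations mu psi u <-> wdvv_equations eta Phi u
      & ricci_equations eta psi u <-> wdvv_equations eta Phi u].
Proof.
move=> u Uu; pose T i j k := partial i (partial j (partial k Phi)) u.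
have T13 i j k : T i j k = T k j i by exact: third_partialC13 Phi_smooth Uu.
(* [psi a] agrees with [partial a Phi] only on [U], so the equality is carried through one
   derivative at a time. *)
have psiT a i k : partial i (partial k (psi a)) u = T i k a.
  apply: (partial_eq_on U_open) Uu => x Ux.
  by apply: (partial_eq_on U_open) Ux => y; exact: psi_Phi.
have gauss : gauss_equations mu psi u <-> wdvv_equations eta Phi u.
  apply: iff_trans (gauss_tensorP T13 c_neq0 mu_eta).
  (* The 0 on the right is replaced by the sum that [H] says vanishes, which leaves two sums to
     compare term by term. *)
  split=> H i j k l; rewrite -[RHS](H i j k l); apply: eq_bigr => a _;
    by apply: eq_bigr => b _; rewrite !psiT.
have ricci : ricci_equations eta psi u <-> wdvv_equations eta Phi u.
  apply: iff_trans (ricci_tensorP eta T13).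
  split=> H k l a b; rewrite -[RHS](H k l a b); apply: eq_bigr => i _;
    by apply: eq_bigr => j _; rewrite !psiT.
by split=> //; apply: iff_trans gauss (iff_sym ricci).
Qed.
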